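(* Let $\pi$ be an $(m,n)$-parking function with bird's eye permutation $\omega$. Then $\pi\circ\omega$ is the shifted parent map of a priority forest on $[n]_0$ with $m$ edges.
   Context: $[n]=\{1,\dots,n\}$, $[n]_0=\{0,\dots,n\}$. An $(m,n)$-parking function is a map $\pi:[m]\to[n]$ such that when cars $1,\dots,m$ arrive in this order to a street with spots $1,\dots,n$, and car $i$ parks at the first empty spot $\ge\pi(i)$, all $m$ cars park. Its bird's eye permutation $\omega:[n]\to[m]$ is the partial permutation sending each occupied spot to the car parked there (undefined at empty spots); $\pi\circ\omega$ is the partial function $[n]\to[n]$ defined on occupied spots. A priority forest on $[n]_0$ is a rooted forest with vertex set $[n]_0$ whose component trees $T_0,T_1,\dots$ are increasing (each non-root vertex has a larger label than its parent) and satisfy: for $j<k$ every label of $T_j$ is smaller than every label of $T_k$. Its shifted parent map is the partial function $s_P:[n]\to[n]$ given by $s_P(i)=p(i)+1$ for each non-root vertex $i$ with parent $p(i)$, and undefined at roots. *)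

(* Defs.v *)
From mathcomp Require Import all_boot.
Set Implicit Arguments. Unset Strict Implicit. Unset Printing Implicit Defensive.

(* World: plain MathComp (boot).  Cars are 1..m, spots are 1..n (as nats).
   A parking preference is pi : nat -> nat; only its values on [m] matter. *)

(* An occupancy state: spot -> the car parked there (None = empty). *)
Definition occupancy := nat -> option nat.

Definition first_empty (n : nat) (occ : occupancy) (p : nat) : option nat :=
  ohead [seq k <- iota p (n.+1 - p) | occ k == None].

Definition park_car (n : nat) (occ : occupancy) (i p : nat) : option occupancy :=
  match first_empty n occ p with
  | Some s => Some (fun k => if k == s then Some i else occ k)
  | None => None
  end.

Fixpoint park_aux (n : nat) (pi : nat -> nat) (cars : seq nat) (occ : occupancy)
  : option occupancy :=
  match cars with
  | [::] => Some occ
  | i :: cs => match park_car n occ i (pi i) with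
               | Some occ' => park_aux n pi cs occ'
               | None => None
               end
  end.

Definition parking_outcome (m n : nat) (pi : nat -> nat) : option occupancy :=
  park_aux n pi (iota 1 m) (fun _ => None).

Definition is_parking_function (m n : nat) (pi : nat -> nat) : Prop :=
  (forall i, 1 <= i <= m -> 1 <= pi i <= n) /\ parking_outcome m n pi <> None.

(* Bird's eye permutation: the final occupancy (spot -> car, partial). *)
Definition birds_eye (m n : nat) (pi : nat -> nat) (omega : occupancy) : Prop :=
  parking_outcome m n pi = Some omega.

(* A rooted forest on [n]_0 given by its parent map (None = root). *)
Definition parent_step (par : nat -> option nat) (x : nat) : nat :=
  if par x is Some p then p else x.

(* the root of the tree containing x (parents strictly decrease, so n+1
   steps suffice to reach the root) *)
Definition forest_root (n : nat) (par : nat -> option nat) (x : nat) : nat :=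
  iter n.+1 (parent_step par) x.

Definition same_tree (n : nat) (par : nat -> option nat) (x y : nat) : bool :=
  forest_root n par x == forest_root n par y.

Definition increasing_forest (n : nat) (par : nat -> option nat) : Prop :=
  (forall i, n < i -> par i = None) /\
  (forall i p, i <= n -> par i = Some p -> p < i).

(* priority forest: increasing, and the component trees can be ordered
   T_0, T_1, ... so that all labels of T_j are below all labels of T_k for
   j < k; i.e. for any two distinct trees, all labels of one are smaller than
   all labels of the other. *)
Definition priority_forest (n : nat) (par : nat -> option nat) : Prop :=
  increasing_forest n par /\
  (forall x y, x <= n -> y <= n -> ~~ same_tree n par x y -> x < y ->
     forall x' y', x' <= n -> y' <= n ->
       same_tree n par x x' -> same_tree n par y y' -> x' < y').

(* number of edges = number of non-root vertices *)
Definition forest_edges (n : nat) (par : nat -> option nat) : nat :=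
  count (fun i => par i != None) (iota 0 n.+1).

Definition shifted_parent (par : nat -> option nat) (i : nat) : option nat :=
  omap S (par i).

(* Main.v *)
Require Import Defs.
From mathcomp Require Import all_boot.
From mathcomp Require Import zify.

Set Implicit Arguments.
Unset Strict Implicit.
Unset Printing Implicit Defensive.

(* Parking keeps the invariant [well_parked]: a car c parked at spot k
   preferred a spot pi c <= k, and all spots from pi c to k are occupied.
   Taking pi c - 1 as the parent of k gives an increasing forest whose roots
   are the empty spots (spot 0 included), and a parent step never jumps over
   an empty spot.  Hence the tree of a vertex x is the one rooted at the last
   empty spot at or below x, so the trees are the intervals between
   consecutive empty spots, which is the priority condition.  The edges are
   the occupied spots, one per car. *)

Definition occupied (occ : occupancy) : pred nat := fun k => occ k != None.

Definition well_parked (n : nat) (pi : nat -> nat) (occ : occupancy) : Prop :=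
  forall k c, occ k = Some c ->
    [/\ 0 < pi c, pi c <= k, k <= n &
         forall j, pi c <= j <= k -> occupied occ j].

Lemma ohead_filter_iotaP (P : pred nat) a len s :
  ohead [seq k <- iota a len | P k] = Some s ->
  [/\ a <= s, s < a + len, P s & forall j, a <= j < s -> ~~ P j].
Proof.
elim: len a => [|len IH] a //=.
case Pa: (P a) => /=.
  by case=> <-; split => //; try lia; move=> j; lia.
move=> /IH [le_as lt_s Ps before_s]; split => //; try lia.
move=> j hj; case: (j =P a) => [-> | ne]; first by rewrite Pa.
apply: before_s; lia.
Qed.

Lemma park_carP n occ i p occ' :
  park_car n occ i p = Some occ' ->
  exists2 s, occ' = (fun k => if k == s then Some i else occ k) &
    [/\ p <= s, s <= n, occ s = None & forall j, p <= j < s -> occupied occ j].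
Proof.
rewrite /park_car /first_empty.
case fe: (ohead _) => [s|] // [<-]; exists s => //.
have [le_ps lt_s /eqP empty_s before_s] := ohead_filter_iotaP fe.
by split => //; lia.
Qed.

Lemma park_car_well_parked n pi occ i occ' :
  0 < pi i -> well_parked n pi occ -> park_car n occ i (pi i) = Some occ' ->
  well_parked n pi occ'.
Proof.
move=> pi_pos parked /park_carP [s -> [le_ps le_sn _ before_s]] k c.
case: (k =P s) => [-> [<-] | ne /parked [c_pos le_ck le_kn run_ck]].
  split => // j hj; rewrite /occupied; case: (j =P s) => // ne.
  apply: before_s; lia.
split => // j /run_ck; rewrite /occupied; by case: (j =P s).
Qed.

Lemma count_occupied_update (occ : occupancy) s i l :
  occ s = None -> uniq l -> s \in l ->
  count (occupied (fun k => if k == s then Some i else occ k)) l =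
  (count (occupied occ) l).+1.
Proof.
move=> empty_s; elim: l => //= x l IH /andP [x_notin_l uniq_l].
rewrite inE /occupied in IH *; case: (x =P s) => [x_s _ | ne s_in_l].
  rewrite x_s empty_s add1n; congr S; apply: eq_in_count => k k_in_l.
  by case: (k =P s) => // k_s; move: x_notin_l; rewrite x_s -k_s k_in_l.
have {}s_in_l : s \in l by case/orP: s_in_l => // /eqP s_x; case: ne.
by rewrite IH // addnS.
Qed.

Lemma park_aux_spec n pi cars occ omega :
  {in cars, forall i, 0 < pi i} -> well_parked n pi occ ->
  park_aux n pi cars occ = Some omega ->
  well_parked n pi omega /\
  count (occupied omega) (iota 0 n.+1) =
  count (occupied occ) (iota 0 n.+1) + size cars.
Proof.
elim: cars occ => [|i cars IH] occ pi_pos parked.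
  by case=> <-; rewrite addn0.
rewrite [park_aux _ _ _ _]/=.
case pc: (park_car n occ i (pi i)) => [occ'|] // run.
have [||parked' ->] := IH occ' _ _ run.
- by move=> j j_in; apply: pi_pos; rewrite inE j_in orbT.
- by apply: park_car_well_parked pc => //; apply: pi_pos; rewrite inE eqxx.
split => //.
have [s -> [_ le_sn empty_s _]] := park_carP pc.
have s_spot : s \in iota 0 n.+1 by rewrite mem_iota; lia.
by rewrite count_occupied_update ?iota_uniq // addSn addnS.
Qed.

Lemma parking_outcome_spec m n pi omega :
  (forall i, 1 <= i <= m -> 0 < pi i) -> parking_outcome m n pi = Some omega ->
  well_parked n pi omega /\ count (occupied omega) (iota 0 n.+1) = m.
Proof.
move=> pi_pos /park_aux_spec [] //.
- by move=> i; rewrite mem_iota => hi; apply: pi_pos; lia.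
- move=> parked ->; split => //.
  by rewrite size_iota (eq_count (a2 := pred0)) ?count_pred0.
Qed.

Section ParkingForest.

Variables (n : nat) (pi : nat -> nat) (omega : occupancy).
Hypothesis omega_parked : well_parked n pi omega.

Definition parking_parent (j : nat) : option nat :=
  omap (fun c => (pi c).-1) (omega j).

Fixpoint last_empty (x : nat) : nat :=
  if x is x'.+1 then (if omega x is None then x else last_empty x') else 0.

Lemma last_empty_le x : last_empty x <= x.
Proof. elim: x => //= x IH; case: (omega x.+1) => //; lia. Qed.

Lemma last_empty_id x : omega x = None -> last_empty x = x.
Proof. by case: x => //= x ->. Qed.

Lemma leq_last_empty x y : x <= y -> last_empty x <= last_empty y.
Proof.
elim: y => [|y IH] le_xy; first by have -> : x = 0 by lia.
case: (x =P y.+1) => [-> //| ne].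
have := IH ltac:(lia); rewrite /=; case: (omega y.+1) => // _.
have := last_empty_le x; lia.
Qed.

Lemma last_empty_occupied_run b x :
  b <= x -> (forall j, b < j <= x -> occupied omega j) ->
  last_empty x = last_empty b.
Proof.
elim: x => [|x IH] le_bx run; first by have -> : b = 0 by lia.
case: (b =P x.+1) => [-> //| ne] /=.
case e: (omega x.+1) => [c|].
  by apply: IH => [|j hj]; [lia | apply: run; lia].
by have := run x.+1 ltac:(lia); rewrite /occupied e.
Qed.

Lemma last_empty_parent_step x :
  last_empty (parent_step parking_parent x) = last_empty x.
Proof.
rewrite /parent_step /parking_parent; case e: (omega x) => [c|] //=.
have [c_pos le_ck _ run_ck] := omega_parked e.
symmetry; apply: last_empty_occupied_run => [|j hj]; first lia.
apply: run_ck; lia.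
Qed.

Lemma parking_parent_lt x p : parking_parent x = Some p -> p < x.
Proof.
rewrite /parking_parent; case e: (omega x) => [c|] //= [<-].
have [? ? _ _] := omega_parked e; lia.
Qed.

Lemma parking_parent_None x : (parking_parent x == None) = (omega x == None).
Proof. by rewrite /parking_parent; case: (omega x). Qed.

Lemma iter_parent_step_root k x :
  let y := iter k (parent_step parking_parent) x in
  parking_parent y = None \/ y + k <= x.
Proof.
elim: k => [|k IH] /=; first by right; lia.
move: IH; set y := iter k _ x; rewrite /parent_step /=.
case e: (parking_parent y) => [p|] [// | descent]; try by left.
by have := parking_parent_lt e; right; lia.
Qed.

Lemma forest_root_parking_parent x :
  x <= n -> forest_root n parking_parent x = last_empty x.
Proof.
move=> le_xn; rewrite /forest_root.
have invariant k :
    last_empty (iter k (parent_step parking_parent) x) = last_empty x.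
  by elim: k => //= k IH; rewrite last_empty_parent_step.
case: (iter_parent_step_root n.+1 x) => [root | ]; last lia.
rewrite -(invariant n.+1) last_empty_id //.
by apply/eqP; rewrite -parking_parent_None root.
Qed.

Lemma parking_parent_increasing : increasing_forest n parking_parent.
Proof.
split=> [i lt_ni | i p _ /parking_parent_lt //].
rewrite /parking_parent; case e: (omega i) => [c|] //.
have [_ _ ? _] := omega_parked e; lia.
Qed.

Lemma parking_parent_priority : priority_forest n parking_parent.
Proof.
split; first exact: parking_parent_increasing.
move=> x y le_xn le_yn; rewrite /same_tree !forest_root_parking_parent //.
move=> /eqP ne lt_xy x' y' le_x'n le_y'n.
rewrite !forest_root_parking_parent // => /eqP tree_x /eqP tree_y.
rewrite ltnNge; apply/negP => /leq_last_empty.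
have := leq_last_empty (ltnW lt_xy); lia.
Qed.

Lemma parking_parent_edges :
  forest_edges n parking_parent = count (occupied omega) (iota 0 n.+1).
Proof. by apply: eq_count => k; rewrite /= parking_parent_None. Qed.

Lemma shifted_parking_parent j :
  shifted_parent parking_parent j = omap pi (omega j).
Proof.
rewrite /shifted_parent /parking_parent; case e: (omega j) => [c|] //=.
have [? _ _ _] := omega_parked e; congr Some; lia.
Qed.

End ParkingForest.

Theorem lemma4p1 (m n : nat) (pi : nat -> nat) (omega : occupancy) :
  is_parking_function m n pi ->
  birds_eye m n pi omega ->
  exists par : nat -> option nat,
    [/\ priority_forest n par,
        forest_edges n par = m &
        forall j, 1 <= j <= n -> shifted_parent par j = omap pi (omega j)].
Proof.
move=> [pi_range _] outcome.
have pi_pos i : 1 <= i <= m -> 0 < pi i by move/pi_range; lia.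
have [parked occupied_m] := parking_outcome_spec pi_pos outcome.
exists (parking_parent pi omega); split.
- exact: parking_parent_priority parked.
- by rewrite parking_parent_edges occupied_m.
- by move=> j _; apply: shifted_parking_parent parked j.
Qed.
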